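(* Let $\Gamma$ be an abelian group written additively and $(G,\varphi)$ a $\Gamma$-gain graph, where $G$ is a finite loopless graph with no isolated vertices in which every connected component is a block. For each vertex $v$ let $\vec B_v$ be the bond $\delta(v)$ oriented towards $v$, and define $\pi_\varphi(v)=\varphi(\vec B_v)$. Then $\pi_\varphi$ is a $\Gamma$-quotient labeling of $G$, and for every oriented bond $\vec B$ of $G$, $\varphi(\vec B)=\pi_\varphi(\vec B)$.
   Context: A block is a connected graph with no cut vertex (under the stated assumptions, each $\delta(v)$ is a bond). A bond is a minimal nonempty edge cut; $\delta(X)$ is the set of non-loop edges with exactly one endpoint in a vertex set $X$. An oriented bond $\vec B$ is a bond $\delta(X)$ with all edges oriented away from $X$ or all towards $X$. A $\Gamma$-gain function assigns to each oriented edge $e$ a value $\varphi(e)\in\Gamma$ with $\varphi(-e)=-\varphi(e)$, and $\varphi(\vec B)=\sum_{e\in\vec B}\varphi(e)$. A $\Gamma$-quotient labeling is a map $\pi:V(G)\to\Gamma$ with $\sum_{v\in V(H)}\pi(v)=0$ for each connected component $H$; for a bond $\delta(X)$ oriented towards $X$, $\pi(\vec B)=\sum_{v\in X}\pi(v)$, and the reverse orientation gets the negative of this. *)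

(* Defs.v *)
From mathcomp Require Import all_boot all_order all_algebra.

Set Implicit Arguments.
Unset Strict Implicit.
Unset Printing Implicit Defensive.

Import GRing.Theory.
Local Open Scope ring_scope.

(* Finite graphs with loops and parallel edges allowed.  The pair [ends e]
   fixes an arbitrary reference orientation of [e]; the two orientations of
   [e] are the darts [(e, true)] (reference) and [(e, false)] (reversed). *)
Record mgraph := MGraph {
  vertex : finType;
  edge : finType;
  ends : edge -> vertex * vertex
}.

Definition dart (G : mgraph) : finType := (edge G * bool)%type.

Section Graphs.

Variable G : mgraph.
Implicit Types (X H : {set vertex G}) (v : vertex G) (d : dart G).

Definition dtail d : vertex G := if d.2 then (ends d.1).1 else (ends d.1).2.
Definition dhead d : vertex G := if d.2 then (ends d.1).2 else (ends d.1).1.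
Definition drev d : dart G := (d.1, ~~ d.2).

Definition loopless : Prop := forall e : edge G, (ends e).1 != (ends e).2.

Definition isolated v : bool := [forall d, dhead d != v].

Definition adj_in X : rel (vertex G) :=
  [rel u v | [&& u \in X, v \in X & [exists d, (dtail d == u) && (dhead d == v)]]].

(* Vertex sets of the connected components of the induced subgraph G[X]. *)
Definition comps X : {set {set vertex G}} :=
  equivalence_partition (connect (adj_in X)) X.

Definition components : {set {set vertex G}} := comps [set: vertex G].

Definition connected X : bool := #|comps X| == 1%N.

Definition cut_vertex X v : bool :=
  (v \in X) && (#|comps X| < #|comps (X :\ v)|)%N.

Definition block X : bool := connected X && [forall v, ~~ cut_vertex X v].

(* Loops never satisfy the exclusive or. *)
Definition delta X : {set edge G} :=
  [set e | ((ends e).1 \in X) (+) ((ends e).2 \in X)].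

Definition edge_cut (C : {set edge G}) : bool := [exists X, C == delta X].

Definition bond (C : {set edge G}) : bool :=
  minset (fun D : {set edge G} => (D != set0) && edge_cut D) C.

Definition towards X : {set dart G} :=
  [set d | (dtail d \notin X) && (dhead d \in X)].

Definition away X : {set dart G} :=
  [set d | (dtail d \in X) && (dhead d \notin X)].

(* An oriented bond, presented by a side X of the cut and a direction. *)
Record obond := OBond {
  ob_side : {set vertex G};
  ob_towards : bool;
  ob_bond : bond (delta ob_side)
}.

Definition ob_darts (B : obond) : {set dart G} :=
  if ob_towards B then towards (ob_side B) else away (ob_side B).

Section Labels.

Variable Gamma : zmodType.
Implicit Types (phi : dart G -> Gamma) (pi : vertex G -> Gamma).

Definition gain_function phi : Prop := forall d, phi (drev d) = - phi d.

Definition gain_sum phi (D : {set dart G}) : Gamma := \sum_(d in D) phi d.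

Definition quotient_labeling pi : Prop :=
  forall H, H \in components -> \sum_(v in H) pi v = 0.

(* For a quotient labeling this depends only on [ob_darts B], not on the
   presentation of the oriented bond: see [label_sum_wd]. *)
Definition label_sum pi (B : obond) : Gamma :=
  if ob_towards B then \sum_(v in ob_side B) pi v
  else - \sum_(v in ob_side B) pi v.

(* In a loopless graph without isolated vertices whose components are blocks,
   delta(v) is a bond ([bond_star]), and [towards [set v]] orients it
   towards v. *)
Definition gain_labeling phi v : Gamma := gain_sum phi (towards [set v]).

End Labels.

Lemma adj_in_sym X : connect_sym (adj_in X).
Proof.
apply: sym_connect_sym => u w; rewrite /adj_in /= andbCA; congr [&& _, _ & _].
by apply/existsP/existsP => -[d /andP[/eqP <- /eqP <-]]; exists (drev d);
  case: d => e []; rewrite /dtail /dhead /= ?eqxx.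
Qed.

Lemma comps_equiv X : {in X & &, equivalence_rel (connect (adj_in X))}.
Proof.
move=> x y z _ _ _; split=> // xy.
exact: (same_connect (adj_in_sym X)).
Qed.

Lemma comps_partition X : partition (comps X) X.
Proof. exact: (equivalence_partitionP (@comps_equiv X)). Qed.

(* A vertex set with no edge leaving it is a union of components. *)
Lemma label_closed (Gamma : zmodType) (pi : vertex G -> Gamma) X :
    quotient_labeling pi ->
    (forall d, dhead d \in X -> dtail d \in X) ->
  \sum_(v in X) pi v = 0.
Proof.
move=> qpi clX.
have clc u v : connect (adj_in setT) u v -> (u \in X) = (v \in X).
  suff half x y : connect (adj_in setT) x y -> y \in X -> x \in X.
    move=> uv; apply/idP/idP; last exact: half.
    by apply: half; rewrite adj_in_sym.
  move=> /connectP[p]; elim: p x => [|z p IH] x /=; first by move=> _ ->.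
  move=> /andP[/and3P[_ _ /existsP[d /andP[/eqP <- /eqP hd]]] pz] ly yX.
  by apply: clX; rewrite hd (IH z).
have -> : \sum_(v in X) pi v = \sum_(v in [set: vertex G] | v \in X) pi v.
  by apply: eq_bigl => v; rewrite in_setT.
have /and3P[/eqP covT trT _] := comps_partition setT.
rewrite -covT big_trivIset_cond //=; apply: big1 => H HC.
have [x xH] : exists x, x \in H.
  apply/set0Pn; apply/eqP => H0; have := comps_partition setT.
  by rewrite /partition -H0 HC andbF andbF.
have {}HE : {in H, forall v, (v \in X) = (x \in X)}.
  move: HC xH => /imsetP[w _ ->]; rewrite !inE /= => wx v.
  by rewrite !inE /= => wv; rewrite -(clc _ _ wv) (clc _ _ wx).
have [xX|xX] := boolP (x \in X).
  apply: etrans (qpi H HC); apply: eq_bigl => v.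
  by have [/HE ->|//] := boolP (v \in H).
apply: big_pred0 => v; have [/HE ->|//] := boolP (v \in H).
exact: negbTE.
Qed.

Lemma label_sum_wd (Gamma : zmodType) (pi : vertex G -> Gamma) :
    quotient_labeling pi ->
  forall B B' : obond, ob_darts B = ob_darts B' ->
    label_sum pi B = label_sum pi B'.
Proof.
move=> qpi.
have tot : \sum_v pi v = 0.
  apply: etrans (label_closed (X := [set: vertex G]) qpi _).
    by apply: eq_bigl => v; rewrite inE.
  by move=> d; rewrite !inE.
pose side (B : obond) := if ob_towards B then ob_side B else ~: ob_side B.
have dartsE B : ob_darts B = towards (side B).
  rewrite /ob_darts /side; case: ifP => // _.
  by apply/setP => d; rewrite !inE negbK.
have labelE B : label_sum pi B = \sum_(v in side B) pi v.
  rewrite /label_sum /side; case: ifP => // _.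
  apply/eqP; rewrite eq_sym -addr_eq0 addrC; apply/eqP.
  apply: etrans tot; rewrite [RHS](bigID (mem (ob_side B))) /=; congr (_ + _).
  by apply: eq_bigl => v; rewrite inE.
have diff X Y : towards X = towards Y -> \sum_(v in X :\: Y) pi v = 0.
  move=> XY; apply: label_closed => // d.
  have /setP/(_ d) := XY; have /setP/(_ (drev d)) := XY.
  rewrite !inE; have -> : dtail (drev d) = dhead d by case: d => e [].
  have -> : dhead (drev d) = dtail d by case: d => e [].
  by do 4![case: (_ \in _)].
move=> B B'; rewrite !dartsE !labelE => XY.
rewrite (big_setID (side B')) [RHS](big_setID (side B)) /=.
by rewrite !diff // setIC.
Qed.

Lemma delta_dart X d :
  (d.1 \in delta X) = (dtail d \in X) (+) (dhead d \in X).
Proof. by case: d => e []; rewrite inE /dtail /dhead //= addbC. Qed.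

Lemma delta1_dart v (e : edge G) : e \in delta [set v] ->
  exists d, [/\ d.1 = e, dhead d = v & dtail d != v].
Proof.
rewrite !inE; case: eqP => [v1|/eqP v1]; case: eqP => [v2|/eqP v2] //= _.
  by exists (e, false).
by exists (e, true).
Qed.

Lemma bond_star : loopless -> (forall v, ~~ isolated v) ->
    (forall H, H \in components -> block H) ->
  forall v, bond (delta [set v]).
Proof.
move=> nol noi blk v.
have tv d : dhead d = v -> dtail d != v.
  by move=> <-; case: d => e []; have := nol e; rewrite /dtail /dhead //= eq_sym.
have key Y d d' : delta Y \subset delta [set v] ->
    dhead d = v -> dhead d' = v -> (dtail d \in Y) = (dtail d' \in Y).
  move=> sY hd hd'.
  pose H := pblock components v.
  have covT : cover components = setT.
    by case/and3P: (comps_partition setT) => /eqP.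
  have HC : H \in components by rewrite pblock_mem // covT inE.
  have mH x : connect (adj_in setT) v x -> x \in H.
    by rewrite /H pblock_equivalence_partition ?inE //; exact: comps_equiv.
  have adjH d2 : dhead d2 = v -> dtail d2 \in H :\ v.
    move=> h2; rewrite !inE tv // mH // adj_in_sym connect1 //.
    by rewrite /adj_in /= !in_setT; apply/existsP; exists d2; rewrite h2 !eqxx.
  have /andP[/eqP c1 /forallP/(_ v)] := blk _ HC.
  rewrite /cut_vertex c1 mH ?connect0 // -leqNgt => le1.
  have /and3P[/eqP cov' tr' _] := comps_partition (H :\ v).
  have : connect (adj_in (H :\ v)) (dtail d) (dtail d').
    rewrite -(pblock_equivalence_partition (@comps_equiv (H :\ v))) ?adjH //.
    rewrite -/(comps _).
    have -> : pblock (comps (H :\ v)) (dtail d)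
              = pblock (comps (H :\ v)) (dtail d').
      by apply: (card_le1_eqP le1); rewrite pblock_mem // cov' adjH.
    by rewrite mem_pblock cov' adjH.
  case/connectP=> p; elim: p (dtail d) => [|z p IH] x /=; first by move=> _ ->.
  move=> /andP[/and3P[xH zH /existsP[d2 /andP[/eqP t2 /eqP h2]]] pz] lz.
  rewrite -(IH z pz lz); apply/eqP; apply: contraT => ne.
  have : d2.1 \in delta [set v].
    apply: (subsetP sY); rewrite delta_dart t2 h2.
    by move: ne; do 2![case: (_ \in Y)].
  rewrite delta_dart t2 h2 !inE.
  by move: xH zH; rewrite !inE => /andP[/negbTE-> _] /andP[/negbTE-> _].
apply/minsetP; split.
  have := noi v; rewrite /isolated negb_forall => /existsP[d].
  rewrite negbK => /eqP hd; apply/andP; split; last by apply/existsP; exists [set v].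
  by apply/set0Pn; exists d.1; rewrite delta_dart !inE hd eqxx (negbTE (tv _ hd)).
move=> D /andP[/set0Pn[e eD] /existsP[Y /eqP DY]] sD; subst D.
apply/eqP; rewrite eqEsubset sD /=; apply/subsetP => e' ve'.
have [d [de hd _]] := delta1_dart (subsetP sD _ eD).
have [d' [de' hd' _]] := delta1_dart ve'.
by move: eD; rewrite -de -de' !delta_dart (key Y d d') // hd hd'.
Qed.

End Graphs.

(* Main.v *)
Require Import Defs.
From mathcomp Require Import all_boot all_order all_algebra.

(** For any vertex set [X], summing the gains of the stars [delta(v)], [v] in
    [X], counts every dart whose head lies in [X].  An edge with both ends in
    [X] contributes its two orientations, whose gains cancel, so only the darts
    entering [X] remain.  A bond is the case where [X] is one of its sides;
    a component is the case where no dart enters [X]. *)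

Set Implicit Arguments.
Unset Strict Implicit.
Unset Printing Implicit Defensive.

Import GRing.Theory.
Local Open Scope ring_scope.

Section GainSums.

Variables (G : mgraph) (Gamma : zmodType) (phi : dart G -> Gamma).
Hypothesis phi_gain : gain_function phi.
Implicit Types (X : {set vertex G}) (d : dart G).

Lemma drevK : involutive (@drev G).
Proof. by case=> e b; rewrite /drev /= negbK. Qed.

Lemma dtail_drev d : dtail (drev d) = dhead d.
Proof. by case: d => e []. Qed.

Lemma dhead_drev d : dhead (drev d) = dtail d.
Proof. by case: d => e []. Qed.

(* The darts are paired edge by edge: reindexing by [drev] would only show that
   twice the sum vanishes, and [Gamma] may have 2-torsion. *)
Lemma sum_gain_symmetric (P : pred (dart G)) :
  (forall d, P (drev d) = P d) -> \sum_(d | P d) phi d = 0.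
Proof.
move=> Psym; rewrite big_mkcond /=.
rewrite (eq_bigr (fun d => if P (d.1, d.2) then phi (d.1, d.2) else 0)); last by case.
rewrite -(pair_bigA _ (fun e b => if P (e, b) then phi (e, b) else 0)) /=.
apply: big1 => e _; rewrite big_bool /=.
rewrite -(Psym (e, true)) /drev /=; case: ifP => _; last by rewrite addr0.
by have := phi_gain (e, true); rewrite /drev /= => ->; rewrite subrr.
Qed.

Lemma gain_sum_away X : gain_sum phi (away X) = - gain_sum phi (towards X).
Proof.
rewrite /gain_sum (reindex_inj (inv_inj drevK)) -sumrN /=.
apply: eq_big => d; last by rewrite phi_gain.
by rewrite !inE dtail_drev dhead_drev andbC.
Qed.

Lemma gain_sum_towards X :
  gain_sum phi (towards X) = \sum_(v in X) gain_labeling phi v.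
Proof.
(* A loop at [v] is not in [towards [set v]], hence the second conjunct. *)
pose P d := (dhead d \in X) && (dtail d != dhead d).
have -> : \sum_(v in X) gain_labeling phi v = \sum_(d | P d) phi d.
  rewrite [RHS](partition_big (@dhead G) (mem X)) /=; last by move=> d /andP[].
  apply: eq_bigr => v vX; apply: eq_bigl => d; rewrite !inE /P.
  by case: (dhead d =P v) => [->|_]; rewrite ?vX ?andbT ?andbF.
(* The darts of [P] with tail in [X] are closed under [drev], so their gains cancel; those with tail
   outside [X] form [towards X]. *)
rewrite (bigID (fun d => dtail d \in X)) /= sum_gain_symmetric ?add0r.
  apply: eq_bigl => d; rewrite !inE /P andbC -andbA.
  case hX: (dhead d \in X) => //=.
  by case: eqP => [->|//]; rewrite hX.
move=> d; rewrite /P dtail_drev dhead_drev eq_sym.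
by do 2![case: (_ \in X)]; rewrite ?andbT ?andbF.
Qed.

(** The ends of a dart are adjacent, so the component of its head also contains its tail. *)
Lemma towards_component X : X \in components G -> towards X = set0.
Proof.
move=> /imsetP[w _ ->]; apply/setP => d; rewrite !inE /=.
apply/negbTE/andP => -[/negP nt h]; apply: nt.
apply: connect_trans h _; rewrite adj_in_sym connect1 //.
by rewrite /adj_in /= !inE; apply/existsP; exists d; rewrite !eqxx.
Qed.

End GainSums.

Theorem theorem4p8 (Gamma : zmodType) (G : mgraph) (phi : dart G -> Gamma)
    (phi_gain : gain_function phi)
    (G_loopless : loopless G)
    (G_no_isolated : forall v : vertex G, ~~ isolated v)
    (G_blocks : forall H : {set vertex G}, H \in components G -> block H) :
  quotient_labeling (gain_labeling phi) /\
  forall B : obond G,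
    gain_sum phi (ob_darts B) = label_sum (gain_labeling phi) B.
Proof.
split=> [H /towards_component H0 | B].
  by rewrite -gain_sum_towards // H0 /gain_sum big_set0.
rewrite /ob_darts /label_sum -gain_sum_towards //.
by case: ifP => // _; exact: gain_sum_away.
Qed.
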